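(* Let $\kappa$ be a regular uncountable cardinal and let $\mathcal S$ be a partition of a nonreflecting stationary subset of $\kappa$ into infinitely many stationary sets, and put $\mu:=|\mathcal S|$. If $\clubsuit_{\mathrm{ad}}(\mathcal S,1,2)$ holds, then there are $2^\mu$ many pairwise nonhomeomorphic Dowker spaces of size $\kappa$.
   Context: A stationary $S\subseteq\kappa$ is nonreflecting if there is no $\alpha<\kappa$ of uncountable cofinality with $S\cap\alpha$ stationary in $\alpha$. A Dowker space is a normal topological space $\mathbb X$ such that $\mathbb X\times[0,1]$ is not normal. For a collection $\mathcal S$ of stationary subsets of $\kappa$, $\clubsuit_{\mathrm{ad}}(\mathcal S,1,2)$ asserts the existence of $\langle\mathcal A_\alpha\mid\alpha\in\bigcup\mathcal S\rangle$ such that: (i) for every limit ordinal $\alpha\in\bigcup\mathcal S$, $\mathcal A_\alpha$ consists of a single cofinal subset of $\alpha$; (ii) for every $\mathcal B\subseteq[\kappa]^\kappa$ of size $2$ and every $S\in\mathcal S$, there are stationarily many $\alpha\in S$ with $\sup(A\cap B)=\alpha$ for all $A\in\mathcal A_\alpha$, $B\in\mathcal B$; (iii) for all distinct $A,A'$ from $\bigcup_{S\in\mathcal S}\bigcup_{\alpha\in S}\mathcal A_\alpha$, $\sup(A\cap A')<\sup(A)$. *)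

(* Defs.v *)
From HB Require Import structures.
From mathcomp Require Import all_boot all_order all_algebra.
From mathcomp Require Import all_classical all_reals all_analysis.
From mathcomp Require wochoice.

Set Implicit Arguments.
Unset Strict Implicit.
Unset Printing Implicit Defensive.

Import Order.TTheory GRing.Theory Num.Theory.
Import numFieldNormedType.Exports.

Local Open Scope classical_set_scope.
Local Open Scope card_scope.
Local Open Scope order_scope.

(* The cardinal kappa is a well-ordered type K whose order type is kappa.     *)
(* An ordinal alpha < kappa is an element a : K, and its set of elements is   *)
(* the initial segment [below a]; kappa itself, as a set, is [set: K].        *)
Section Ordinals.
Context {d : Order.disp_t} {K : orderType d}.
Implicit Types (a b x y : K) (I A B C S : set K).

Definition below a : set K := [set x | x < a].

Definition limit_ordinal a :=
  below a !=set0 /\ forall x, x < a -> exists2 y, x < y & y < a.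

(* I stands for an ordinal <= kappa: either [below a] or [set: K]. *)
Definition cofinal_in I A :=
  A `<=` I /\ forall x, I x -> exists2 y, A y & x <= y.

Definition club_in I C :=
  cofinal_in I C /\
  forall a, I a -> limit_ordinal a -> supremums (C `&` below a) a -> C a.

Definition stationary_in I S :=
  S `<=` I /\ forall C, club_in I C -> S `&` C !=set0.

Definition stationary S := stationary_in [set: K] S.

Definition uncountable_cofinality a :=
  forall A, cofinal_in (below a) A -> ~ countable A.

Definition nonreflecting S :=
  ~ exists2 a, uncountable_cofinality a &
      stationary_in (below a) (S `&` below a).

(* sup A < sup B, where the supremum of a set without upper bound in K is     *)
(* kappa: the first supremum must be an element of K, the second need not be. *)
Definition sup_lt A B :=
  exists2 a, supremums A a & forall b, supremums B b -> a < b.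

Definition clubsuit_ad_1_2 (SS : set (set K)) :=
  exists AA : K -> set (set K),
  [/\ forall a, (\bigcup_(S in SS) S) a -> limit_ordinal a ->
        exists2 A, cofinal_in (below a) A & AA a = [set A],
      forall BB : set (set K),
        (forall B, BB B -> B #= [set: K]) -> BB #= `I_2 ->
        forall S, SS S ->
        stationary [set a | S a /\
          forall A B, AA a A -> BB B -> supremums (A `&` B) a]
    & forall A A',
        (\bigcup_(S in SS) \bigcup_(a in S) AA a) A ->
        (\bigcup_(S in SS) \bigcup_(a in S) AA a) A' ->
        A <> A' -> sup_lt (A `&` A') A].

End Ordinals.

(* The clauses: K is an ordinal; it is a cardinal, i.e. it has no bijection   *)
(* with a smaller ordinal; it is uncountable; its cofinality is itself.       *)
Definition regular_uncountable_cardinal (d : Order.disp_t) (K : orderType d) :=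
  [/\ wochoice.well_order (<=%O : rel K),
      forall a : K, ~ (below a #= [set: K]),
      ~ countable [set: K]
    & forall A : set K, cofinal_in [set: K] A -> A #= [set: K]].

Definition homeomorphic (X Y : topologicalType) :=
  exists (f : X -> Y) (g : Y -> X),
    [/\ cancel f g, cancel g f, continuous f & continuous g].

(* The subtype of [0, 1], carrying the subspace topology. *)
Definition unit_interval (R : realType) : topologicalType :=
  set_type [set` `[0%R : R, 1%R : R]].

(* The library's [normal_space] only asks that disjoint closed sets can be    *)
(* separated; [hausdorff_space] is the usual T1/T2 convention for normal      *)
(* spaces, without which Dowker spaces are easily produced.                   *)
Definition dowker_space (R : realType) (X : topologicalType) :=
  [/\ hausdorff_space X, normal_space X
    & ~ normal_space (X * unit_interval R)%type].

(* Main.v *)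
Require Import Defs.
From HB Require Import structures.
From mathcomp Require Import all_boot all_order all_algebra.
From mathcomp Require Import all_classical all_reals all_analysis.

Set Implicit Arguments.
Unset Strict Implicit.
Unset Printing Implicit Defensive.

Import Order.TTheory GRing.Theory Num.Theory.
Import numFieldNormedType.Exports.

Local Open Scope order_scope.
Local Open Scope classical_set_scope.
Local Open Scope card_scope.

(* Points of a level n > 0 are limit ordinals a with a ladder A a contained   *)
(* in level n - 1, and U is open when it contains a tail of A a for each such *)
(* a in U. Below a fixed ordinal the ladders have pairwise disjoint tails:    *)
(* by induction, cutting limits of uncountable cofinality along a club that   *)
(* misses T, as T does not reflect. Hence a bounded closed set can be         *)
(* separated from any disjoint closed set. Guessing pairs of sets shows that  *)
(* two unbounded closed sets meet: each spreads to all higher levels, and two *)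
(* unbounded subsets of one level share a limit in the next. So the space is  *)
(* normal, while the closed sets of points of level >= n decrease to the      *)
(* empty set although open supersets of them always have a common point,      *)
(* which is incompatible with normality of the product with [0, 1].           *)
(*   Two spaces with different sets of members of SS on positive levels are   *)
(* not homeomorphic. A homeomorphism f has a closure point a that is a limit  *)
(* point in the first space and isolated in the second; the open set of all   *)
(* y >= a then contains f a but no f x with x < a, although such x cluster    *)
(* at a. Keeping infinitely many members of SS aside to fill all the levels   *)
(* leaves one space for each subset of SS.                                    *)

(** * Regular cardinals *)

(** Every space lives on [K] and is built from the guessed ladders, thinned so that each descends
    exactly one level. Normality rests on two facts. Nonreflection makes the ladders up to any
    ordinal simultaneously disjointifiable ([disjointifies_le]), which gives [separate_bounded];
    guessing pairs makes two cofinal closed sets meet ([closed_cofinal_meet]). The second fact also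
    shows that an open superset of the points of level at least [n] has bounded complement, so
    countably many such supersets share a point ([open_level_ge_meet]), and this defeats normality
    of the product. For the count, infinitely many blocks of the partition fill the levels in every
    space, while an injective copy of [SS] among the other blocks codes a subset: coded blocks carry
    ladders, uncoded ones are isolated. [ladder_space_not_homeomorphic] then distinguishes the
    spaces. *)

Section RegularCardinal.
Context {d : Order.disp_t} {K : orderType d}.
Hypothesis hK : regular_uncountable_cardinal K.
Implicit Types (a b x y : K) (A B C S : set K).

Lemma well_order_min A : A !=set0 -> exists2 m, A m & forall x, A x -> m <= x.
Proof.
move=> [x Ax]; have [wo _ _ _] := hK.
have /wo[m [[/asboolP Am mA] _]] : wochoice.nonempty (fun x => `[< A x >]).
  by exists x; exact/asboolP.
by exists m => // y Ay; apply: mA; exact/asboolP.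
Qed.

Lemma well_order_ind (P : K -> Prop) :
  (forall a, (forall b, b < a -> P b) -> P a) -> forall a, P a.
Proof.
move=> IH a; apply: contrapT => nPa.
have [m nPm mmin] := @well_order_min [set x | ~ P x] (ex_intro _ a nPa).
apply: nPm; apply: IH => b; rewrite ltNge => /negP bm.
by apply: contrapT => /mmin.
Qed.

Lemma not_cofinal_bounded A : ~ cofinal_in [set: K] A ->
  exists b, forall x, A x -> x < b.
Proof.
move=> nA; apply: contrapT => nb; apply: nA; split=> // x _.
apply: contrapT => nx; apply: nb; exists x => y Ay.
by rewrite ltNge; apply/negP => xy; apply: nx; exists y.
Qed.

Lemma bounded_not_cofinal A b : (forall x, A x -> x < b) ->
  ~ cofinal_in [set: K] A.
Proof. by move=> Ab [_ /(_ b I)[y /Ab yb]]; rewrite leNgt yb. Qed.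

Lemma countable_bounded A : countable A -> exists b, forall x, A x -> x < b.
Proof.
move=> cA; apply: not_cofinal_bounded => cofA; have [_ _ uncK reg] := hK.
apply: uncK; apply: sub_countable cA.
by have := reg _ cofA; rewrite card_eq_sym card_eq_le => /andP[].
Qed.

Lemma cardinal_inhabited : inhabited K.
Proof.
have [_ _ uncK _] := hK; apply: contrapT => nK; apply: uncK.
suff -> : [set: K] = set0 by exact: countable0.
by rewrite -subset0 => x _; apply: nK.
Qed.

Lemma seq_bounded (f : nat -> K) : exists b, forall n, f n < b.
Proof.
have [|b hb] := @countable_bounded (range f).
  exact: sub_countable (card_image_le _ _) (countableP _).
by exists b => n; apply: hb; exists n.
Qed.

Lemma image_below_bounded (g : K -> K) a : exists b, forall x, x < a -> g x < b.
Proof.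
have [_ card _ reg] := hK.
have [|b hb] := @not_cofinal_bounded (g @` below a); last first.
  by exists b => x xa; apply: hb; exists x.
move=> /reg; rewrite card_eq_sym card_eq_le => /andP[Kg _].
apply: (card a); rewrite card_eq_le subset_card_le//=.
exact: card_le_trans Kg (card_image_le _ _).
Qed.

Lemma exists_gt a : exists b, a < b.
Proof. by have [b hb] := seq_bounded (fun=> a); exists b; exact: hb 0%N. Qed.

Lemma exists_succ a : exists2 b, a < b & forall x, a < x -> b <= x.
Proof. exact: (well_order_min (exists_gt a)). Qed.

Lemma cofinal_nonlimit : cofinal_in [set: K] [set a | ~ limit_ordinal a].
Proof.
split=> // x _; have [b xb bmin] := exists_succ x.
exists b; last exact: ltW.
by move=> [_ /(_ _ xb)[y /bmin]]; rewrite leNgt => /negP.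
Qed.

Lemma cofinal_setI_gt A a : cofinal_in [set: K] A ->
  cofinal_in [set: K] (A `&` [set x | a < x]).
Proof.
move=> [_ cA]; split=> // x _; have [b ab] := exists_gt (Order.max a x).
have [y Ay yb] := cA b I; move: ab; rewrite gt_max => /andP[ab xb].
by exists y; [split=> //=; exact: lt_le_trans yb|exact/ltW/(lt_le_trans xb)].
Qed.

Lemma cofinal_bigcup (F : nat -> set K) : cofinal_in [set: K] (\bigcup_n F n) ->
  exists n, cofinal_in [set: K] (F n).
Proof.
move=> cF; apply: contrapT => nF.
have /choice[f hf] n : exists b, forall x, F n x -> x < b.
  by apply: not_cofinal_bounded => cFn; apply: nF; exists n.
have [b hb] := seq_bounded f.
by apply: (bounded_not_cofinal _ cF) => // x [n _ /hf]; move/lt_trans; apply.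
Qed.

Lemma club_closure_points (g : K -> K) :
  club_in [set: K] [set a | limit_ordinal a /\ forall x, x < a -> g x < a].
Proof.
split; last first.
  move=> a _ lima [ubC lbC]; split=> // x xa.
  have [c [[limc hc] ca] xc] : exists2 c, ([set a | limit_ordinal a /\
      forall x, x < a -> g x < a] `&` below a) c & x < c.
    apply: contrapT => nc; suff : a <= x by rewrite leNgt xa.
    apply: lbC => c hc; rewrite leNgt; apply/negP => xc; apply: nc.
    by exists c.
  exact: lt_trans (hc _ xc) ca.
split=> // x0 _.
(* [h x] exceeds [x] and all values of [g] up to [x]; the closure point will be the supremum of the
   iterates of [h] from [x0]. *)
have /choice[h hh] x : exists b, x < b /\ forall y, y <= x -> g y < b.
  have [s xs smin] := exists_succ x; have [b hb] := image_below_bounded g s.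
  exists (Order.max s b); split; first by rewrite lt_max xs.
  by move=> y yx; rewrite lt_max (hb _ (le_lt_trans yx xs)) orbT.
have [b hb] := seq_bounded (fun n => iter n h x0).
have [a ha amin] := @well_order_min
  [set a | forall n, iter n h x0 < a] (ex_intro _ b hb).
have below_a x : x < a -> exists n, x <= iter n h x0.
  move=> xa; apply: contrapT => nx; suff : a <= x by rewrite leNgt xa.
  by apply: amin => n; rewrite ltNge; apply/negP => xn; apply: nx; exists n.
exists a; last exact: ltW (ha 0%N).
split; first split.
- by exists x0; exact: ha 0%N.
- move=> x /below_a[n xn]; exists (iter n.+1 h x0); last exact: ha.
  by apply: le_lt_trans xn _; exact: (hh _).1.
- move=> x /below_a[n xn]; apply: lt_trans (ha n.+1).
  exact: (hh _).2.
Qed.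

End RegularCardinal.

(** * Ladder systems and their spaces *)

Section Ladders.
Context {d : Order.disp_t} {K : orderType d}.
Implicit Types (L : K -> set K) (a b x : K) (f : K -> K).

(** A point whose [L a] is not cofinal is simply isolated, so ladders may be thinned freely. *)
Definition ladder_point L a :=
  limit_ordinal a /\ cofinal_in (below a) (L a).

Definition almost_disjoint_ladders L :=
  forall a a', ladder_point L a -> ladder_point L a' -> a <> a' ->
  exists2 b, b < a & forall x, L a x -> L a' x -> x < b.

Definition disjointifies L (I : set K) f :=
  (forall a, I a -> ladder_point L a -> f a < a) /\
  forall a a' x, I a -> I a' -> ladder_point L a -> ladder_point L a' ->
    L a x -> L a' x -> f a <= x -> f a' <= x -> a = a'.

End Ladders.

(** * Disjointifying the ladders below an ordinal *)

Section LadderSystem.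
Context {d : Order.disp_t} {K : orderType d}.
Hypothesis hK : regular_uncountable_cardinal K.
Variables (L : K -> set K) (T : set K).
Implicit Types (a b x y : K) (f g : K -> K).

Hypothesis adL : almost_disjoint_ladders L.
Hypothesis LT : forall a, ladder_point L a -> T a.
Hypothesis nrT : nonreflecting T.

(* [n] and [c] chop [below b] into pieces: the ladder points in one piece     *)
(* share the value of [n], which bounds them, and [c a] is an upper bound     *)
(* below [a] for the earlier pieces.                                          *)
Definition chopping b (n c : K -> K) :=
  (forall a, ladder_point L a -> a < b -> [/\ n a < b, a <= n a & c a < a]) /\
  forall a a', ladder_point L a -> ladder_point L a' -> a < b -> a' < b ->
    n a <> n a' -> a <= c a' \/ a' <= c a.

(** Enumerate [A] and let [n a] be its first-listed element at or above [a]. The finitely many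
    elements listed earlier lie below [a], so some [c a < a] bounds them; of two distinct values of
    [n], the one listed earlier is thus bounded by the other's [c]. *)
Lemma chopping_countable b A : cofinal_in (below b) A -> countable A ->
  exists n c, chopping b n c.
Proof.
move=> [Ab cofA] /countable_injP[f injf].
have bnd a k : ladder_point L a -> (forall y, A y -> (f y < k)%N -> y < a) ->
    exists2 c, c < a & forall y, A y -> (f y < k)%N -> y <= c.
  move=> [[[x0 x0a] _] _]; elim: k => [|k IH] hk; first by exists x0.
  have [|c ca hc] := IH; first by move=> y Ay yk; apply: hk => //; exact: ltnW.
  have [[y [Ay fy]]|ny] := pselect (exists y, A y /\ f y = k); last first.
    exists c => // y Ay; rewrite ltnS leq_eqVlt => /orP[/eqP fy|]; last exact: hc.
    by case: ny; exists y.
  exists (Order.max c y); first by rewrite gt_max ca hk// fy.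
  move=> z Az; rewrite ltnS leq_eqVlt le_max => /orP[/eqP fz|zk].
    by rewrite (injf z y) ?inE ?fz ?fy// lexx orbT.
  by rewrite hc.
have /choice[h hh] a : exists nc : K * K, ladder_point L a -> a < b ->
    [/\ A nc.1, a <= nc.1, nc.2 < a &
        forall y, A y -> (f y < f nc.1)%N -> y <= nc.2].
  have [[pa ab]|np] := pselect (ladder_point L a /\ a < b); last first.
    by exists (a, a) => ? ?; case: np.
  have [y0 Ay0 ay0] := cofA _ ab.
  have ex : exists k, `[< exists y, [/\ A y, a <= y & f y = k] >].
    by exists (f y0); apply/asboolP; exists y0.
  case: (ex_minnP ex) => k /asboolP[y [Ay ay fy]] kmin.
  have [|c ca hc] := bnd a k pa.
    move=> z Az zk; rewrite ltNge; apply/negP => az.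
    by move: zk; rewrite ltnNge kmin//; apply/asboolP; exists z.
  by exists (y, c) => _ _; split=> //= z Az; rewrite fy; exact: hc.
exists (fst \o h), (snd \o h); split=> [a pa ab|a a' pa pa' ab a'b nn] /=.
  by have [An ? ? _] := hh a pa ab; split=> //; exact: Ab.
have [An an _ hc] := hh a pa ab; have [An' an' _ hc'] := hh a' pa' a'b.
have [lt|lt|/injf] := ltngtP (f (h a).1) (f (h a').1).
- by left; apply: le_trans an _; exact: hc'.
- by right; apply: le_trans an' _; exact: hc.
- by rewrite !inE => /(_ An An').
Qed.

(** Here [n a] is the least element of [C] at or above [a], and [c a] bounds the part of [C] below
    [a]. If no such bound existed below [a], then [a] would belong to [C], although ladder points
    are in [T]. *)
Lemma chopping_club b C : club_in (below b) C -> (forall x, C x -> ~ T x) ->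
  exists n c, chopping b n c.
Proof.
move=> [[Cb cofC] clC] CT.
have /choice[h hh] a : exists nc : K * K, ladder_point L a -> a < b ->
    [/\ C nc.1, a <= nc.1, forall y, C y -> a <= y -> nc.1 <= y, nc.2 < a &
        forall y, C y -> y < a -> y <= nc.2].
  have [[pa ab]|np] := pselect (ladder_point L a /\ a < b); last first.
    by exists (a, a) => ? ?; case: np.
  have [y0 Cy0 ay0] := cofC _ ab.
  have [y [Cy ay] ymin] := @well_order_min _ _ hK [set y | C y /\ a <= y]
    (ex_intro _ y0 (conj Cy0 ay0)).
  have [c ca hc] : exists2 c, c < a & forall y, C y -> y < a -> y <= c.
    apply: contrapT => nc; apply: (CT a); last exact: LT.
    apply: clC => //; first exact: pa.1.
    split=> [x [_ /ltW]//|u uC]; rewrite leNgt; apply/negP => ua.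
    by apply: nc; exists u => // z Cz za; apply: uC.
  by exists (y, c) => _ _; split=> //= z Cz az; apply: ymin.
exists (fst \o h), (snd \o h); split=> [a pa ab|a a' pa pa' ab a'b nn] /=.
  by have [Cn ? _ ? _] := hh a pa ab; split=> //; exact: Cb.
have [Cn an nmin _ hc] := hh a pa ab; have [Cn' an' nmin' _ hc'] := hh a' pa' a'b.
have [lt|lt|//] := ltgtP (h a).1 (h a').1.
- left; apply: le_trans an _; apply: hc' => //.
  by rewrite ltNge; apply/negP => /nmin'-/(_ Cn); rewrite leNgt lt.
- right; apply: le_trans an' _; apply: hc => //.
  by rewrite ltNge; apply/negP => /nmin-/(_ Cn'); rewrite leNgt lt.
Qed.

Lemma exists_chopping b : exists n c, chopping b n c.
Proof.
have [ucb|] := pselect (uncountable_cofinality b); last first.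
  by move=> /existsNP[A /not_implyP[cofA /contrapT]]; exact: chopping_countable.
have [C clubC CT] : exists2 C, club_in (below b) C & forall x, C x -> ~ T x.
  apply: contrapT => nC; apply: nrT; exists b => //; split=> [x []//|C clubC].
  apply: contrapT => nTC; apply: nC; exists C => // x Cx Tx; apply: nTC.
  by exists x; split=> //; split=> //; exact: clubC.1.1.
exact: chopping_club clubC CT.
Qed.

(** Within a piece, the function for the common bound [n a] works. Between pieces, cutting one tail
    at its [c] lifts it above the whole of the other ladder. *)
Lemma disjointifies_below b :
  (forall c, c < b -> exists f, disjointifies L [set a | a <= c] f) ->
  exists f, disjointifies L (below b) f.
Proof.
move=> IH; have [n [c [hnc hc]]] := exists_chopping b.
have /choice[F hF] u :
    exists f, u < b -> disjointifies L [set a | a <= u] f.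
  have [ub|nu] := pselect (u < b); last by exists id.
  by have [f hf] := IH u ub; exists f.
exists (fun a => Order.max (F (n a) a) (c a)); split=> [a ab pa|].
  have [nb an ca] := hnc a pa ab.
  by rewrite gt_max ca andbT; apply: (hF _ nb).1.
move=> a a' x ab a'b pa pa' ax a'x.
rewrite !ge_max => /andP[fx cx] /andP[fx' cx'].
have [nb an ca] := hnc a pa ab; have [nb' an' ca'] := hnc a' pa' a'b.
have [xa xa'] : x < a /\ x < a' by split; [exact: pa.2.1|exact: pa'.2.1].
have [nn|/hc] := pselect (n a = n a').
  by apply: ((hF _ nb).2 a a' x) => //=; rewrite nn.
move=> /(_ pa pa' ab a'b)[ac|ac].
  by move: (lt_le_trans xa (le_trans ac cx')); rewrite ltxx.
by move: (lt_le_trans xa' (le_trans ac cx)); rewrite ltxx.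
Qed.

Lemma disjointifies_le b : exists f, disjointifies L [set a | a <= b] f.
Proof.
move: b; apply: (well_order_ind hK) => b /disjointifies_below[f [fa hf]].
have [pb|npb] := pselect (ladder_point L b); last first.
  have lt_b a : a <= b -> ladder_point L a -> a < b.
    by rewrite le_eqVlt => /orP[/eqP ->|].
  exists f; split=> [a ab pa|a a' x ab a'b pa pa'].
    by apply: fa => //; exact: lt_b.
  by apply: hf => //; exact: lt_b.
have [[[x0 x0b] _] _] := pb.
have /choice[u hu] a : exists u, ladder_point L a -> a < b ->
    u < a /\ forall x, L a x -> L b x -> x < u.
  have [[pa ab]|np] := pselect (ladder_point L a /\ a < b); last first.
    by exists a => ? ?; case: np.
  have [|v] := adL pa pb; first by move=> e; move: ab; rewrite e ltxx.
  by exists v.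
(* Any value below [b] will do at [b], since [u] makes the earlier tails avoid all of [L b]. *)
exists (fun a => if a == b then x0 else Order.max (f a) (u a)); split.
  move=> a /=; rewrite le_eqVlt; case: eqP => [->//|_ /= ab pa].
  by rewrite gt_max fa//=; have [] := hu a pa ab.
move=> a a' x /=; rewrite (le_eqVlt a b) (le_eqVlt a' b).
case: eqP => [-> _|_ /= ab]; case: eqP => [-> _|_ /= a'b] pa pa' ax a'x //.
- move=> _; rewrite ge_max => /andP[_]; rewrite leNgt => /negP[].
  by apply: (hu a' pa' a'b).2.
- rewrite ge_max => /andP[_] + _; rewrite leNgt => /negP[].
  by apply: (hu a pa ab).2.
- rewrite !ge_max => /andP[fx _] /andP[fx' _].
  exact: hf fx fx'.
Qed.

End LadderSystem.

(** * The topology of a ladder system *)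

Section LadderSpace.
Context {d : Order.disp_t} {K : orderType d}.
Implicit Types (L : K -> set K) (a b x y : K).

Definition ladder_space L : Type := K.

Definition ladder_open L (U : set (ladder_space L)) :=
  forall a, ladder_point L a -> U a ->
  exists2 b : K, b < a & forall x, L a x -> b <= x -> U x.

Let ladder_openT L : ladder_open [set: ladder_space L].
Proof. by move=> a [[[b ba] _] _] _; exists b. Qed.

Let ladder_openI L : setI_closed (@ladder_open L).
Proof.
move=> U V oU oV a pa [/(oU a pa)[b ba hb] /(oV a pa)[c ca hc]].
exists (Order.max b c) => [|x ax]; first by rewrite gt_max ba.
by rewrite ge_max => /andP[bx cx]; split; [exact: hb|exact: hc].
Qed.

Let ladder_open_bigcup L (I : Type) (F : I -> set (ladder_space L)) :
  (forall i, ladder_open (F i)) -> ladder_open (\bigcup_i F i).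
Proof.
move=> oF a pa [i _ /(oF i a pa)[b ba hb]].
by exists b => // x ax bx; exists i => //; exact: hb.
Qed.

HB.instance Definition _ L := Choice.on (ladder_space L).
HB.instance Definition _ L := isOpenTopological.Build (ladder_space L)
  (@ladder_openT L) (@ladder_openI L) (@ladder_open_bigcup L).

Lemma open_ladderE L (U : set (ladder_space L)) : open U = ladder_open U.
Proof. by []. Qed.

Lemma open_gt L a : open ([set x : K | a < x] : set (ladder_space L)).
Proof.
rewrite open_ladderE => c pc /= /pc.1.2[b ab bc].
by exists b => // x _; exact: lt_le_trans.
Qed.

Lemma open_ge L a : ~ ladder_point L a ->
  open ([set x : K | a <= x] : set (ladder_space L)).
Proof.
move=> npa; rewrite open_ladderE => c pc /=; rewrite le_eqVlt => /orP[/eqP ac|ac].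
  by rewrite ac in npa.
by exists a.
Qed.

Lemma closed_ladder L (H : set (ladder_space L)) a : closed H ->
  ladder_point L a -> (forall b, b < a -> exists x, [/\ L a x, H x & b <= x]) ->
  H a.
Proof.
move=> /closed_openC; rewrite open_ladderE => oH pa hb.
apply: contrapT => /(oH a pa)[b /hb[x [ax Hx bx]]].
by move=> /(_ x ax bx).
Qed.

Lemma ladder_space_closed1 L a : closed ([set a] : set (ladder_space L)).
Proof.
rewrite -openC open_ladderE => c pc /= ca.
have [ac|ca'] := ltP a c.
  have [b ab bc] := pc.1.2 a ac.
  by exists b => // x _ bx xa; move: (lt_le_trans ab bx); rewrite xa ltxx.
have [[[b bc] _] _] := pc; exists b => // x cx _ xa.
by move: (lt_le_trans (pc.2.1 _ cx) ca'); rewrite xa ltxx.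
Qed.

End LadderSpace.

(** * Separating a bounded closed set *)

Section Separation.
Context {d : Order.disp_t} {K : orderType d}.
Hypothesis hK : regular_uncountable_cardinal K.
Variables (L : K -> set K) (T : set K).
Hypothesis adL : almost_disjoint_ladders L.
Hypothesis LT : forall a, ladder_point L a -> T a.
Hypothesis nrT : nonreflecting T.
Local Notation X := (ladder_space L).

(** The least superset of [H] containing, with each of its ladder points [a], the tail of [L a] from
    [g a] on. *)
Inductive ladder_hull (g : K -> K) (H : set K) : K -> Prop :=
| ladder_hull_base x : H x -> ladder_hull g H x
| ladder_hull_step a x : ladder_hull g H a -> ladder_point L a ->
    L a x -> g a <= x -> ladder_hull g H x.

Lemma ladder_hull_le g (H : set K) b : (forall x, H x -> x <= b) ->
  forall x, ladder_hull g H x -> x <= b.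
Proof.
move=> Hb x; elim=> [{}x /Hb//|a {}x _ ab pa /pa.2.1 xa _].
exact: le_trans (ltW xa) ab.
Qed.

Lemma ladder_hull_open g (H : set K) b : (forall x, H x -> x <= b) ->
  (forall a, a <= b -> ladder_point L a -> g a < a) ->
  open (ladder_hull g H : set X).
Proof.
move=> Hb ga; rewrite open_ladderE => a pa Ua; exists (g a) => [|x ax gx].
  by apply: ga => //; exact: ladder_hull_le Ua.
exact: ladder_hull_step pa ax gx.
Qed.

Lemma ladder_hull_disjoint g (H E : set K) b :
  (forall x, H x -> x <= b) ->
  (forall a x, a <= b -> ladder_point L a -> ~ E a ->
    L a x -> g a <= x -> ~ E x) ->
  (forall x, H x -> ~ E x) ->
  forall x, ladder_hull g H x -> ~ E x.
Proof.
move=> Hb gE HE x; elim=> [{}x /HE//|a {}x Ua nEa pa ax gx].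
by apply: (gE a x) => //; exact: ladder_hull_le Ua.
Qed.

Lemma separate_bounded (H E : set X) b : closed H -> closed E ->
  H `&` E = set0 -> (forall x : K, H x -> x <= b) ->
  exists U V : set X, [/\ open U, open V, H `<=` U, E `<=` V & U `&` V = set0].
Proof.
move=> cH cE HE0 Hb.
have HE x : H x -> ~ E x by move=> Hx Ex; have : (H `&` E) x by []; rewrite HE0.
have [f [fa hf]] := disjointifies_le hK adL LT nrT b.
have avoid (D : set X) a : closed D -> ladder_point L a -> exists2 c, c < a &
    ~ D a -> forall x, L a x -> c <= x -> ~ D x.
  move=> /closed_openC; rewrite open_ladderE => oD pa.
  have [Da|nDa] := pselect (D a).
    by have [[[c ca] _] _] := pa; exists c.
  by have [c ca hc] := oD a pa nDa; exists c.
have /choice[g hg] a : exists c, a <= b -> ladder_point L a ->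
    [/\ c < a, f a <= c, ~ E a -> forall x, L a x -> c <= x -> ~ E x &
        ~ H a -> forall x, L a x -> c <= x -> ~ H x].
  have [[ab pa]|np] := pselect (a <= b /\ ladder_point L a); last first.
    by exists a => ? ?; case: np.
  have [c ca hc] := avoid E a cE pa; have [e ea he] := avoid H a cH pa.
  exists (Order.max (f a) (Order.max c e)) => _ _; split.
  - by rewrite !gt_max ca ea fa.
  - by rewrite le_max lexx.
  - by move=> /hc + x ax; rewrite !ge_max => + /and3P[_ cx _]; apply.
  - by move=> /he + x ax; rewrite !ge_max => + /and3P[_ _ ex]; apply.
(* Truncation keeps the hull of [E'] below [b], where [f] is disjointifying; points beyond [b] are
   added at the end. *)
pose E' : set K := [set x | E x /\ x <= b].
have E'b x : E' x -> x <= b by case.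
have ga a : a <= b -> ladder_point L a -> g a < a.
  by move=> ab pa; have [] := hg a ab pa.
have UE : forall x, ladder_hull g H x -> ~ E x.
  apply: ladder_hull_disjoint Hb _ HE => a x ab /(hg a ab)[_ _ + _].
  by move=> /[apply]; apply.
have VH : forall x, ladder_hull g E' x -> ~ H x.
  apply: ladder_hull_disjoint E'b _ _ => [a x ab|x [Ex _] /HE//].
  move=> /(hg a ab)[_ _ _].
  by move=> /[apply]; apply.
(* A common point of the hulls enters both through tails, because [UE] and [VH] exclude base points.
   As [g] dominates [f], both tails belong to the same ladder point, to which the induction
   hypothesis applies. *)
have UV x : ladder_hull g H x -> ~ ladder_hull g E' x.
  elim=> [{}x Hx /VH//|a {}x Ua IH pa ax gx Vx].
  have := UE _ (ladder_hull_step Ua pa ax gx); case: Vx ax gx.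
    by move=> y [Ey _] _ _ /(_ Ey).
  move=> a' y Va' pa' a'y ga'y ay gay _; apply: IH.
  have ab := ladder_hull_le Hb Ua; have a'b := ladder_hull_le E'b Va'.
  have [_ fg _ _] := hg a ab pa; have [_ fg' _ _] := hg a' a'b pa'.
  by rewrite (hf a a' y)//; [exact: le_trans gay|exact: le_trans ga'y].
exists (ladder_hull g H), ((ladder_hull g E' : set X) `|` [set x : K | b < x]).
split.
- exact: ladder_hull_open Hb ga.
- by apply: openU; [exact: ladder_hull_open E'b ga|exact: open_gt].
- by move=> x; exact: ladder_hull_base.
- move=> x Ex; have [xb|bx] := leP (x : K) b; last by right.
  by left; apply: ladder_hull_base.
apply/disjoints_subset => x Ux [/(UV _ Ux)//|/=].
by rewrite ltNge (ladder_hull_le Hb Ux).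
Qed.

End Separation.

(** * The Dowker property *)

Lemma exists_unit_interval (R : realType) (x : R) : (0 <= x <= 1)%R ->
  exists s : unit_interval R, set_val s = x.
Proof.
(* The scope selects the interval rather than the set it denotes. *)
move=> x01; have hx : x \in [set` (`[0%R : R, 1%R : R])%O].
  by rewrite inE/= in_itv.
by exists (exist _ x hx).
Qed.

Section Dowker.
Context {d : Order.disp_t} {K : orderType d}.
Hypothesis hK : regular_uncountable_cardinal K.
Variables (L : K -> set K) (T : set K) (lev : K -> nat).
Hypothesis adL : almost_disjoint_ladders L.
Hypothesis LT : forall a, ladder_point L a -> T a.
Hypothesis nrT : nonreflecting T.
Local Notation X := (ladder_space L).
Local Notation level n := [set x : K | lev x = n].

Definition clusters_at (A B : set K) a :=
  forall b, b < a -> exists x, [/\ A x, B x & b <= x].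

Hypothesis lev_ladder : forall a x, ladder_point L a -> L a x ->
  lev a = (lev x).+1.
Hypothesis cofinal_lev0 : cofinal_in [set: K] (level 0%N).
Hypothesis guess : forall n (B C : set K), B `<=` level n -> C `<=` level n ->
  cofinal_in [set: K] B -> cofinal_in [set: K] C ->
  forall x, exists a, [/\ x <= a, ladder_point L a, lev a = n.+1,
    clusters_at (L a) B a & clusters_at (L a) C a].

Lemma cofinal_level n : cofinal_in [set: K] (level n).
Proof.
elim: n => [//|n IH]; split=> // x _.
by have [a [xa _ an _ _]] := guess (fun=> id) (fun=> id) IH IH x; exists a.
Qed.

Lemma closed_cofinal_level (H : set X) n m : closed H -> (n <= m)%N ->
  cofinal_in [set: K] (H `&` level n) -> cofinal_in [set: K] (H `&` level m).
Proof.
move=> cH + cHn; elim: m => [|m IH]; first by rewrite leqn0 => /eqP <-.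
rewrite leq_eqVlt => /orP[/eqP <-//|/IH cHm]; split=> // x _.
have HW : H `&` level m `<=` level m by move=> ? [].
have [a [xa pa an aH _]] := guess HW HW cHm cHm x.
exists a => //; split=> //; apply: (closed_ladder cH pa) => b.
move=> /aH[y [ay [Hy _] bx]].
by exists y.
Qed.

Lemma closed_cofinal_meet (H E : set X) : closed H -> closed E ->
  cofinal_in [set: K] H -> cofinal_in [set: K] E -> H `&` E !=set0.
Proof.
move=> cH cE; have split_level (D : set X) : cofinal_in [set: K] D ->
    exists n, cofinal_in [set: K] (D `&` level n).
  move=> cD; apply: (cofinal_bigcup hK).
  suff -> : \bigcup_n (D `&` level n) = D by [].
  by rewrite eqEsubset; split=> [x [n _ []]//|x Dx]; exists (lev x).
move=> /split_level[n /(closed_cofinal_level cH (leq_maxl n _)) cHn].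
move=> /split_level[m /(closed_cofinal_level cE (leq_maxr _ m)) cEm].
have [x] := cardinal_inhabited hK.
have sub (D : set X) : D `&` level (maxn n m) `<=` level (maxn n m).
  by move=> ? [].
have [a [_ pa _ aH aE]] := guess (sub H) (sub E) (cHn m) (cEm n) x.
exists a; split; apply: closed_ladder pa _ => // b.
  by move=> /aH[y [ay [Hy _] bx]]; exists y.
by move=> /aE[y [ay [Ey _] bx]]; exists y.
Qed.

Lemma ladder_space_normal (R : realType) : normal_space X.
Proof.
apply/(@normal_openP R) => H E cH cE HE0.
have [cofH|] := pselect (cofinal_in [set: K] H); last first.
  move=> /(not_cofinal_bounded)[b hb].
  by apply: (separate_bounded hK adL LT nrT (b := b)) => // x /hb/ltW.
have [cofE|] := pselect (cofinal_in [set: K] E).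
  by have := closed_cofinal_meet cH cE cofH cofE; rewrite HE0 => -[].
move=> /(not_cofinal_bounded)[b hb].
have EH0 : E `&` H = set0 by rewrite setIC.
have [U [V [oU oV EU HV UV0]]] :=
    separate_bounded hK adL LT nrT cE cH EH0 (fun x Ex => ltW (hb x Ex)).
by exists V, U; split=> //; rewrite setIC.
Qed.

Lemma ladder_space_hausdorff (R : realType) : hausdorff_space X.
Proof.
rewrite open_hausdorff => x y xy.
have /(@normal_openP R) := ladder_space_normal R.
have c1 (z : X) : closed [set z] by exact: ladder_space_closed1.
move=> /(_ _ _ (c1 x) (c1 y))[].
  by apply/disjoints_subset => _ ->; exact/eqP.
move=> U [V [oU oV xU yV UV0]]; exists (U, V); last by split=> //=; apply/eqP.
by rewrite !inE; split; [exact: xU|exact: yV].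
Qed.

Lemma open_level_lt n : open ([set x : K | (lev x < n)%N] : set X).
Proof.
rewrite open_ladderE => a pa /= an; have [[[b ba] _] _] := pa.
by exists b => // x ax _; apply: leq_trans an; rewrite (lev_ladder pa ax) ltnS.
Qed.

(** The complement of [U n] is closed and misses the closed cofinal set of points of level at least
    [n], so it is bounded. A point above all these bounds lies in every [U n]. *)
Lemma open_level_ge_meet (U : nat -> set X) :
  (forall n, open (U n)) -> (forall n x, (n <= lev x)%N -> U n x) ->
  exists x, forall n, U n x.
Proof.
move=> oU hU.
have /choice[b hb] n : exists b, forall x : K, ~ U n x -> x < b.
  have [//|b hb] := @not_cofinal_bounded _ K (~` U n); last by exists b.
  move=> cofU; have cF : closed (~` [set x : K | (lev x < n)%N] : set X).
    by apply: open_closedC; exact: open_level_lt.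
  have [|x [/= nx]] := closed_cofinal_meet cF (open_closedC (oU n)) _ cofU.
    split=> // x _; have [y /= yn xy] := (cofinal_level n).2 x I.
    by exists y => //=; rewrite yn ltnn.
  by apply; apply: hU; rewrite leqNgt; exact/negP.
have [c hc] := seq_bounded hK b.
exists c => n; apply: contrapT => /hb cb.
by have := lt_trans (hc n) cb; rewrite ltxx.
Qed.

(** The bottom edge [A] and the region [B] above the graph of 1/([lev x] + 1) are disjoint and
    closed. The slice of [V] at height [t n] contains all levels from [n] on, so some [x] is in all
    slices; the points [(x, t n)] of [V] then converge to a point of [A]. *)
Lemma ladder_space_product_not_normal (R : realType) :
  ~ normal_space (X * unit_interval R)%type.
Proof.
move=> /(@normal_openP R) nX.
have [t0 t0E] : exists s : unit_interval R, set_val s = 0%R.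
  by apply: exists_unit_interval; rewrite lexx ler01.
have /choice[t tE] n : exists s : unit_interval R, set_val s = (n.+1%:R^-1)%R.
  apply: exists_unit_interval.
  by rewrite invr_ge0 ler0n/= invf_le1 ?ltr0n// ler1n.
have val_cont : continuous (set_val : unit_interval R -> R).
  exact: initial_continuous.
pose A := [set p : X * unit_interval R | (set_val p.2 <= 0 :> R)%R].
pose B := [set p : X * unit_interval R |
  ((lev p.1).+1%:R^-1 <= set_val p.2 :> R)%R].
have le_inv m n : (m <= n)%N -> (n.+1%:R^-1 <= m.+1%:R^-1 :> R)%R.
  by move=> mn; rewrite lef_pV2 ?posrE ?ltr0n// ler_nat.
have cA : closed A.
  apply: (@preimage_closed _ _ (set_val \o snd) [set r : R | r <= 0]%R).
    by move=> p _; apply: continuous_comp; [exact: cvg_snd|exact: val_cont].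
  exact: closed_le.
have cB : closed B.
  rewrite -openC openE => -[x s] /= /negP; rewrite -ltNge => sx.
  exists ([set y : X | (lev y < (lev x).+1)%N],
          set_val @^-1` [set r : R | (r < (lev x).+1%:R^-1)%R]);
    first split => /=.
  - by apply: open_nbhs_nbhs; split; [exact: open_level_lt|exact: ltnSn].
  - by apply: val_cont; apply: open_nbhs_nbhs; split=> //; exact: open_lt.
  - move=> [y r] /= [yx rx]; apply/negP; rewrite -ltNge.
    by apply: lt_le_trans rx _; exact: le_inv.
have [|U [V [oU oV AU BV UV0]]] := nX _ _ cA cB.
  apply/disjoints_subset => -[x s] /= s0; apply/negP; rewrite -ltNge.
  by apply: le_lt_trans s0 _; rewrite invr_gt0 ltr0n.
have [x hx] : exists x : X, forall n, V (x, t n).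
  apply: (open_level_ge_meet (U := fun n => [set x | V (x, t n)])) => [n|n x nx].
    apply: (@open_comp _ _ (fun x : X => (x, t n))) oV => x _.
    apply: (@cvg_pair _ _ _ (nbhs x) (nbhs x) (nbhs (t n)) _ _ _ id (fun=> t n)).
      exact: cvg_id.
    exact: cvg_cst.
  by apply: BV; rewrite /B /= tE; exact: le_inv.
have : nbhs (x, t0) U.
  by apply: open_nbhs_nbhs; split=> //; apply: AU; rewrite /A /= t0E.
move=> [[P Q] /= [Px Qt0] PQU]; case: Qt0 => S [[W oW <-] Wt0 WQ].
have [n _ hn] : \forall n \near \oo, W (n.+1%:R^-1)%R.
  apply: (@cvg_harmonic R W); apply: open_nbhs_nbhs; split=> //.
  by rewrite -t0E.
have : (U `&` V) (x, t n); last by rewrite UV0.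
split; last exact: hx.
apply: PQU; split=> /=; first exact: nbhs_singleton.
by apply: WQ; rewrite /= tE; exact: (hn n (leqnn n)).
Qed.

Lemma ladder_space_dowker (R : realType) : dowker_space R X.
Proof.
split; [exact: ladder_space_hausdorff|exact: ladder_space_normal|].
exact: ladder_space_product_not_normal.
Qed.

End Dowker.

(** * Guessing and nonhomeomorphic spaces *)

Section Homeomorphism.
Context {d : Order.disp_t} {K : orderType d}.
Implicit Types (L : K -> set K) (S : set K).

Lemma homeomorphic_sym (X Y : topologicalType) :
  homeomorphic X Y -> homeomorphic Y X.
Proof. by move=> [f [g [fg gf cf cg]]]; exists g, f. Qed.

(* A closure point [a] of the homeomorphism [f] and its inverse satisfies     *)
(* [a <= f a], and the preimage of the open set of all [y >= a] misses        *)
(* everything below [a].                                                      *)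
Lemma ladder_space_not_homeomorphic L L' S :
  (forall a, S a -> ~ ladder_point L' a) ->
  (forall g : K -> K, exists a,
    [/\ S a, ladder_point L a & forall x, x < a -> g x < a]) ->
  ~ homeomorphic (ladder_space L) (ladder_space L').
Proof.
move=> SL' SL [f [g [fg gf cf cg]]].
have [a [Sa pa ha]] := SL (fun x : K => Order.max (f x : K) (g x : K)).
have afa : (a : K) <= f a.
  rewrite leNgt; apply/negP => /ha.
  by rewrite gt_max => /andP[_]; rewrite (fg a) ltxx.
have := (continuousP _).1 cf _ (open_ge (SL' a Sa)).
rewrite open_ladderE => /(_ a pa afa)[b ba hb].
have [x ax bx] := pa.2.2 b ba.
have /= := hb x ax bx; rewrite leNgt => /negP; apply.
by have := ha x (pa.2.1 x ax); rewrite gt_max => /andP[].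
Qed.

End Homeomorphism.

(** * The guessing principle in terms of ladders *)

Section Guessing.
Context {d : Order.disp_t} {K : orderType d}.
Hypothesis hK : regular_uncountable_cardinal K.
Implicit Types (a b x y : K) (A B C S : set K).

Lemma supremums_cofinal a A : limit_ordinal a -> cofinal_in (below a) A ->
  supremums A a.
Proof.
move=> [_ lima] [Aa cofA]; split=> [x /Aa/ltW//|u uA].
rewrite leNgt; apply/negP => /lima[y uy ya]; have [z Az yz] := cofA y ya.
by have := lt_le_trans uy (le_trans yz (uA z Az)); rewrite ltxx.
Qed.

Lemma supremums_clusters_at A B a : supremums (A `&` B) a -> clusters_at A B a.
Proof.
move=> [_ lb] b ba; apply: contrapT => nx; suff : a <= b by rewrite leNgt ba.
apply: lb => x [Ax Bx]; rewrite leNgt; apply/negP => /ltW bx; apply: nx.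
by exists x.
Qed.

(** The form in which guessing is applied: stationarity is reduced to one guess at a closure point
    of a given [g], and [B] and [C] may coincide. *)
Definition clubsuit_ladder (SS : set (set K)) (A : K -> set K) :=
  [/\ forall a, (\bigcup_(S in SS) S) a -> limit_ordinal a ->
        cofinal_in (below a) (A a),
      forall a a', (\bigcup_(S in SS) S) a -> (\bigcup_(S in SS) S) a' ->
        limit_ordinal a -> limit_ordinal a' -> a <> a' ->
        exists2 b, b < a & forall x, A a x -> A a' x -> x < b
    & forall S B C (g : K -> K), SS S ->
        cofinal_in [set: K] B -> cofinal_in [set: K] C ->
        exists a, [/\ S a, limit_ordinal a, forall x, x < a -> g x < a,
          clusters_at (A a) B a & clusters_at (A a) C a]].

Lemma clubsuit_ad_ladder SS : clubsuit_ad_1_2 SS -> 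
  exists A : K -> set K, clubsuit_ladder SS A.
Proof.
move=> [AA [AA1 AAguess AAdisj]].
have /choice[A hA] a : exists A, (\bigcup_(S in SS) S) a -> limit_ordinal a ->
    cofinal_in (below a) A /\ AA a = [set A].
  have [[Ta la]|np] := pselect ((\bigcup_(S in SS) S) a /\ limit_ordinal a).
    by have [A cA AE] := AA1 a Ta la; exists A.
  by exists set0 => ? ?; case: np.
exists A; split=> [a Ta /(hA a Ta)[]//|a a' Ta Ta' la la' aa'|S B C g SSS cB cC].
  have [[Aa cofA] AAE] := hA a Ta la; have [[Aa' cofA'] AAE'] := hA a' Ta' la'.
  have AA' : A a <> A a'.
    move=> AE; have [lt|lt|//] := ltgtP a a'.
      have [y] := cofA' a lt; rewrite -AE => /Aa.
      by rewrite /below/= ltNge => /negP.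
    have [y] := cofA a' lt; rewrite AE => /Aa'.
    by rewrite /below/= ltNge => /negP.
  have inAA c : (\bigcup_(S in SS) S) c -> limit_ordinal c ->
      (\bigcup_(S in SS) \bigcup_(a in S) AA a) (A c).
    move=> Tc lc; have [_ E] := hA c Tc lc; case: Tc => S SSS Sc.
    by exists S => //; exists c => //; rewrite E.
  have [s [sub _] hs] := AAdisj _ _ (inAA a Ta la) (inAA a' Ta' la') AA'.
  have [b sb ba] := la.2 s (hs a (supremums_cofinal la (conj Aa cofA))).
  by exists b => // x ax a'x; apply: le_lt_trans sb; exact: sub.
(* The principle guesses two distinct sets; when [B = C], a proper final segment replaces [C]. *)
have [C' [C'C cC' BC']] : exists C',
    [/\ C' `<=` C, cofinal_in [set: K] C' & B <> C'].
  have [BC|] := pselect (B = C); last by move=> BC; exists C; split.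
  have [x0] := cardinal_inhabited hK; have [b Bb _] := cB.2 x0 I.
  exists (B `&` [set x | b < x]); split.
  - by rewrite BC; exact: subIsetl.
  - exact: cofinal_setI_gt.
  - by move=> E; move: Bb; rewrite E => -[_ /=]; rewrite ltxx.
have [_ _ _ reg] := hK.
have [||_ /(_ _ (club_closure_points hK g))] := AAguess [set B; C'] _ _ S SSS.
- by move=> D [->|->]; exact: reg.
- apply/eq_cardSP; exists B; first by left.
  by rewrite setUC setUDK ?card_set1// => D [/= -> E]; exact: BC'.
move=> [a [[Sa guess] [la ga]]]; exists a.
have [|_ AAE] := hA a _ la; first by exists S.
split=> //; first by apply/supremums_clusters_at/guess; [rewrite AAE|left].
have /supremums_clusters_at acc : supremums (A a `&` C') a.
  by apply: guess; [rewrite AAE|right].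
by move=> b /acc[x [Ax /C'C Cx bx]]; exists x.
Qed.

End Guessing.

(** * Thinning the ladders to consecutive levels *)

Section LeveledLadders.
Context {d : Order.disp_t} {K : orderType d}.
Hypothesis hK : regular_uncountable_cardinal K.
Variables (T : set K) (SS : set (set K)) (A : K -> set K) (blk : K -> SS).
Hypothesis nrT : nonreflecting T.
Hypothesis coverSS : \bigcup_(S in SS) S = T.
Hypothesis clubA : clubsuit_ladder SS A.
Hypothesis blkE : forall a (s : SS), val s a -> blk a = s.
Variables (N : set SS) (q : SS -> nat).
Hypothesis qN : forall n, exists2 s, N s & q s = n.
Implicit Types (a b x y : K) (s : SS).

Definition ladder_level a : nat :=
  if `[< [/\ T a, limit_ordinal a & N (blk a)] >] then (q (blk a)).+1 else 0%N.

(** On level 0, which includes all blocks outside [N], the equation fails for every [x]: the ladder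
    is empty and the point isolated. *)
Definition leveled_ladder a : set K :=
  A a `&` [set x | ladder_level a = (ladder_level x).+1].

Lemma in_block s a : val s a -> (\bigcup_(S in SS) S) a.
Proof. by exists (val s) => //; exact/set_mem/(valP s). Qed.

Lemma ladder_point_level a : ladder_point leveled_ladder a ->
  [/\ T a, limit_ordinal a & N (blk a)].
Proof.
move=> [[[x xa] _] [_ /(_ x xa)[y [_ /=]]]].
by rewrite /ladder_level; case: asboolP.
Qed.

Lemma ladder_level_block s a : N s -> val s a -> limit_ordinal a ->
  ladder_level a = (q s).+1.
Proof.
move=> Ns sa la; rewrite /ladder_level (blkE sa); case: asboolP => // -[].
by split=> //; rewrite -coverSS; exact: in_block sa.
Qed.

Lemma leveled_ladder_ad : almost_disjoint_ladders leveled_ladder.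
Proof.
move=> a a' /ladder_point_level[Ta la _] /ladder_point_level[Ta' la' _] aa'.
have [_ + _] := clubA; rewrite coverSS => /(_ a a' Ta Ta' la la' aa')[b ba hb].
by exists b => // x [ax _] [a'x _]; exact: hb.
Qed.

Lemma cofinal_ladder_level0 : cofinal_in [set: K] [set x | ladder_level x = 0%N].
Proof.
split=> // x _; have [y ny xy] := (cofinal_nonlimit hK).2 x I; exists y => //=.
by rewrite /ladder_level; case: asboolP => // -[].
Qed.

(** For [a] in block [s], thinning keeps all of [A a] on level [q s], hence every point of [B] and
    [C] in it. Clustering survives, and it makes the thinned ladder cofinal. *)
Lemma leveled_ladder_guess s (B C : set K) (g : K -> K) : N s ->
  B `<=` [set x | ladder_level x = q s] ->
  C `<=` [set x | ladder_level x = q s] ->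
  cofinal_in [set: K] B -> cofinal_in [set: K] C ->
  exists a, [/\ val s a, ladder_point leveled_ladder a,
    forall x, x < a -> g x < a,
    clusters_at (leveled_ladder a) B a & clusters_at (leveled_ladder a) C a].
Proof.
move=> Ns Bs Cs cB cC; have [cofA _ guess] := clubA.
have [a [sa la ga aB aC]] := guess (val s) B C g (set_mem (valP s)) cB cC.
have lift (D : set K) : D `<=` [set x | ladder_level x = q s] ->
    clusters_at (A a) D a -> clusters_at (leveled_ladder a) D a.
  move=> Ds aD b /aD[x [Ax Dx bx]]; exists x; split=> //; split=> //=.
  by rewrite (ladder_level_block Ns sa la) (Ds x Dx).
exists a; split=> //; [|exact: lift|exact: lift]; split=> //; split.
  by move=> x [/(cofA a (in_block sa) la).1].
by move=> b /(lift _ Bs aB)[x [Lx _ bx]]; exists x.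
Qed.

Lemma leveled_ladder_cofinal_guess n (B C : set K) :
  B `<=` [set x | ladder_level x = n] -> C `<=` [set x | ladder_level x = n] ->
  cofinal_in [set: K] B -> cofinal_in [set: K] C ->
  forall x, exists a, [/\ x <= a, ladder_point leveled_ladder a,
    ladder_level a = n.+1, clusters_at (leveled_ladder a) B a &
    clusters_at (leveled_ladder a) C a].
Proof.
have [s Ns <-] := qN n; move=> Bs Cs cB cC x.
have [a [sa pa ga aB aC]] := leveled_ladder_guess (fun=> x) Ns Bs Cs cB cC.
exists a; split=> //; last exact: ladder_level_block pa.1.
by have [[[y ya] _] _] := pa; exact/ltW/(ga y).
Qed.

Lemma leveled_ladder_stationary s (g : K -> K) : N s -> exists a,
  [/\ val s a, ladder_point leveled_ladder a & forall x, x < a -> g x < a].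
Proof.
move=> Ns.
have cs := cofinal_level cofinal_ladder_level0 leveled_ladder_cofinal_guess (q s).
have [a [sa pa ga _ _]] := leveled_ladder_guess g Ns (fun=> id) (fun=> id) cs cs.
by exists a.
Qed.

Lemma leveled_ladder_dowker (R : realType) :
  dowker_space R (ladder_space leveled_ladder).
Proof.
apply: (@ladder_space_dowker _ _ hK leveled_ladder T ladder_level).
- exact: leveled_ladder_ad.
- by move=> a /ladder_point_level[].
- exact: nrT.
- by move=> a x _ [].
- exact: cofinal_ladder_level0.
- exact: leveled_ladder_cofinal_guess.
Qed.

End LeveledLadders.

(* Shifting along an embedded copy of [nat] frees the even places of the copy. *)
Lemma infinite_coinfinite_injection (I : eqType) (e : nat -> I) : injective e ->
  exists2 h : I -> I, injective h & forall n t, h t <> e n.*2.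
Proof.
move=> einj.
have /choice[h hh] t : exists u, (forall n, t = e n -> u = e n.*2.+1) /\
    ((forall n, t <> e n) -> u = t).
  have [[n ->]|nt] := pselect (exists n, t = e n).
    by exists (e n.*2.+1); split=> [m /einj ->//|/(_ n)].
  by exists t; split=> // n tn; case: nt; exists n.
have hP t : (exists2 n, t = e n & h t = e n.*2.+1) \/
            (forall n, t <> e n) /\ h t = t.
  have [[n tn]|nt] := pselect (exists n, t = e n).
    by left; exists n => //; exact: (hh t).1.
  have nt' n : t <> e n by move=> tn; apply: nt; exists n.
  by right; split=> //; exact: (hh t).2.
exists h => [t u|n t]; last first.
  case: (hP t) => [[m _ ->] /einj E|[nt ->]]; last exact: nt.
  by have := congr1 odd E; rewrite /= !odd_double.
case: (hP t) => [[m -> ->]|[nt ->]]; case: (hP u) => [[k -> ->]|[nu ->]] //.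
- by move=> /einj[/double_inj ->].
- by move=> E; case: (nu m.*2.+1).
- by move=> /nt.
Qed.

Theorem theoremA1 (R : realType) (d : Order.disp_t) (K : orderType d)
    (hK : regular_uncountable_cardinal K)
    (T : set K) (hT : stationary T) (hTnr : nonreflecting T)
    (SS : set (set K)) (hSS : partition SS id T)
    (hSSstat : forall S : set K, SS S -> stationary S)
    (hSSinf : infinite_set SS)
    (hclub : clubsuit_ad_1_2 SS) :
  exists X : set (set_type SS) -> topologicalType,
    (forall i : set (set_type SS),
        dowker_space R (X i) /\ [set: X i] #= [set: K]) /\
    (forall i j : set (set_type SS), i <> j -> ~ homeomorphic (X i) (X j)).
Proof.
have [A clubA] := clubsuit_ad_ladder hK hclub.
have [coverSS trivSS _] := hSS.
have [e einj] : exists e : nat -> SS, injective e.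
  have /infiniteP/card_leP[f] := hSSinf.
  exists (fun n => f (exist _ n (mem_setT n))) => m n.
  by move=> /(inj (f := f)); rewrite !in_setT => /(_ isT isT)[].
have [h hinj he] := infinite_coinfinite_injection einj.
have /choice[blk blkE] a : exists s : SS, forall s' : SS, val s' a -> s = s'.
  have [[s sa]|ns] := pselect (exists s : SS, val s a).
    exists s => s' s'a; apply/val_inj.
    apply: (trivSS _ _ (set_mem (valP s)) (set_mem (valP s'))).
    by exists a.
  by exists (e 0%N) => s' s'a; case: ns; exists s'.
have /choice[q qE] s : exists m, forall n, s = e n.*2 -> m = n.
  have [[n ->]|ns] := pselect (exists n, s = e n.*2).
    by exists n => m /einj/double_inj.
  by exists 0%N => n sn; case: ns; exists n.
(* The blocks [e n.*2] fill level [n.+1] in every space; [h] avoids them, so [h t] carries ladders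
   exactly when [t] is in [i]. *)
pose N (i : set SS) : set SS := [set s | (exists n, s = e n.*2) \/ (h @` i) s].
have qN i n : exists2 s, N i s & q s = n.
  by exists (e n.*2); [left; exists n|exact: qE].
pose L i := leveled_ladder T A blk (N i) q.
exists (fun i => ladder_space (L i)); split=> [i|i j ij].
  split; last exact: card_eqxx.
  exact: (leveled_ladder_dowker hK hTnr coverSS clubA blkE (qN i)).
have main k l t : k t -> ~ l t ->
    ~ homeomorphic (ladder_space (L k)) (ladder_space (L l)).
  move=> kt nlt; apply: (@ladder_space_not_homeomorphic _ _ _ _ (val (h t))).
    move=> a ha /ladder_point_level[_ _]; rewrite (blkE _ _ ha).
    by move=> [[n /he]|[u lu /hinj ut]]//; rewrite ut in lu.
  move=> g; apply: (leveled_ladder_stationary hK coverSS clubA blkE (qN k)).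
  by right; exists t.
have [[t [it njt]]|] := pselect (exists t, i t /\ ~ j t).
  exact: main it njt.
move=> nij; have [[t [jt nit]]|nji] := pselect (exists t, j t /\ ~ i t).
  by move=> /homeomorphic_sym; exact: main jt nit.
case: ij; rewrite eqEsubset; split=> t ht; apply: contrapT => nt.
  by apply: nij; exists t.
by apply: nji; exists t.
Qed.
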